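(* Let $G$ and $G'$ be graphs with no isolated vertices such that the VCIr-TAR graphs of $G$ and $G'$ are isomorphic. Then $G$ and $G'$ have the same order and there is a relabeling of the vertices of $G'$ such that $G$ and $G'$ have exactly the same VCIr-sets.
   Context: Graphs are finite, simple, undirected. For a graph $G$ and $S\subseteq V(G)$, an edge $e=\{x,y\}$ of $G$ is a private edge of $u\in S$ (relative to $S$) if $S\cap e=\{u\}$. $S$ is a VCIr-set if every element of $S$ has a private edge. The VCIr-TAR graph of $G$ has as vertices the VCIr-sets of $G$, two being adjacent iff one is obtained from the other by adding or removing exactly one vertex. *)

(* Defs.v *)
From HB Require Import structures.
From mathcomp Require Import all_boot.

Set Implicit Arguments.
Unset Strict Implicit.
Unset Printing Implicit Defensive.

Record sgraph := SGraph {
  vertex :> finType;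
  adj : rel vertex;
  adj_sym : symmetric adj;
  adj_irrefl : irreflexive adj }.

Definition edges (G : sgraph) : {set {set G}} :=
  [set [set p.1; p.2] | p in [pred p : G * G | adj p.1 p.2]].

Definition no_isolated (G : sgraph) : Prop :=
  forall x : G, exists y : G, adj x y.

Definition isomorphic (G H : sgraph) : Prop :=
  exists f : G -> H, bijective f /\ forall x y : G, adj (f x) (f y) = adj x y.

Definition private_edge (G : sgraph) (S : {set G}) (u : G) (e : {set G}) : bool :=
  (e \in edges G) && (S :&: e == [set u]).

Definition VCIr_set (G : sgraph) (S : {set G}) : bool :=
  [forall u in S, exists e : {set G}, private_edge S u e].

Section TAR.
Variable G : sgraph.

Definition VCIr_type : finType := {S : {set G} | VCIr_set S}.

Definition TAR_adj : rel VCIr_type := fun A B =>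
  [exists v : G, (v \notin val A) && (val B == v |: val A)
              || (v \in val A) && (val B == val A :\ v)].

Lemma TAR_adj_sym : symmetric TAR_adj.
Proof.
have sub A B : TAR_adj A B -> TAR_adj B A.
  move=> /existsP[v /orP[] /andP[vA /eqP eB]]; apply/existsP; exists v.
    by rewrite eB setU11 setU1K // eqxx orbT.
  by rewrite eB setD11 setD1K // eqxx.
by move=> A B; apply/idP/idP; apply: sub.
Qed.

Lemma TAR_adj_irrefl : irreflexive TAR_adj.
Proof.
move=> A; apply/existsP=> -[v /orP[] /andP[vA /eqP eA]].
  by move: vA; rewrite eA setU11.
by move: vA; rewrite eA setD11.
Qed.

Definition VCIr_TAR : sgraph := SGraph TAR_adj_sym TAR_adj_irrefl.

End TAR.

(* Main.v *)
Require Import Defs.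
From mathcomp Require Import all_boot.

Set Implicit Arguments.
Unset Strict Implicit.
Unset Printing Implicit Defensive.

(** VCIr-sets form a down-closed family containing all singletons when no
    vertex is isolated.  An injective homomorphism [f] of TAR graphs sends the
    singletons to neighbours of [Z = f set0], which defines an injection [phi]
    on vertices, and induction on [#|S|] gives [f S = Z (+) phi @: S]: two
    sets at distance 2 in a hypercube have exactly two common neighbours, and
    one of them is already taken.  For an isomorphism, translation by [Z]
    therefore maps the [phi]-image of one down-closed family onto the other
    one, and down-closure forces the two families to be equal: remove [Z]
    before translating, so that translation becomes union with [Z], and then
    pass to a subset. *)

Definition symdiff (T : finType) (A B : {set T}) : {set T} :=
  [set x | (x \in A) (+) (x \in B)].

Section SymmetricDifference.
Variable T : finType.
Implicit Types A B : {set T}.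

Lemma symdiff0 A : symdiff A set0 = A.
Proof. by apply/setP=> x; rewrite !inE addbF. Qed.

Lemma symdiffA : associative (@symdiff T).
Proof. by move=> A B C; apply/setP=> x; rewrite !inE addbA. Qed.

Lemma symdiffK A : involutive (symdiff A).
Proof. by move=> B; apply/setP=> x; rewrite !inE addKb. Qed.

Lemma symdiff_setD A B : symdiff A (B :\: A) = A :|: B.
Proof. by apply/setP=> x; rewrite !inE; case: (x \in A); case: (x \in B). Qed.

Lemma symdiff1_in A x : x \in A -> A :\ x = symdiff A [set x].
Proof.
by move=> xA; apply/setP=> y; rewrite !inE; case: eqP => [->|_];
   rewrite ?xA ?addbF.
Qed.

Lemma symdiff1_notin A x : x \notin A -> x |: A = symdiff A [set x].
Proof.
by move=> xA; apply/setP=> y; rewrite !inE; case: eqP => [->|_];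
   rewrite ?(negPf xA) ?addbF.
Qed.

(** If [u] were neither [a] nor [b], membership of [u] on the right would force [u = v], and
    cancelling it would give [a = b]. *)
Lemma symdiff_set1_eq (a b u v : T) : a != b ->
  symdiff [set a] [set u] = symdiff [set b] [set v] -> u = a \/ u = b.
Proof.
move=> ab /setP e; have := e a; have := e u; rewrite !inE !eqxx (negPf ab) /=.
case: (u =P a) => [|ua]; first by left.
case: (u =P b) => [|ub]; first by right.
case: (u =P v) => [<-|//] _.
by rewrite [a == u]eq_sym; case: eqP.
Qed.

End SymmetricDifference.

Section VCIrSets.
Variable G : sgraph.

Lemma VCIr_set0 : VCIr_set (set0 : {set G}).
Proof. by apply/forall_inP=> u; rewrite inE. Qed.

Lemma VCIr_set1 (x : G) : no_isolated G -> VCIr_set [set x].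
Proof.
move=> /(_ x)[y xy]; apply/forall_inP=> u /set1P->.
apply/existsP; exists [set x; y]; apply/andP; split.
  by apply/imsetP; exists (x, y).
by apply/eqP/setP=> z; rewrite !inE; case: (z == x).
Qed.

(** A private edge of [u] relative to [B] stays private relative to [A], because
    [A :&: e = A :&: (B :&: e)]. *)
Lemma VCIr_setS (A B : {set G}) : A \subset B -> VCIr_set B -> VCIr_set A.
Proof.
move=> AB /forall_inP hB; apply/forall_inP=> u uA.
have /existsP[e /andP[eE /eqP Be]] := hB u (subsetP AB u uA).
apply/existsP; exists e; rewrite /private_edge eE /=.
rewrite -(setIidPl AB) -setIA Be; apply/eqP/setIidPr.
by rewrite sub1set.
Qed.

(** Adding and removing a vertex are both the toggling of one vertex, which spares later case
    splits. *)
Lemma TAR_adjP (A B : VCIr_TAR G) :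
  reflect (exists v, val B = symdiff (val A) [set v]) (adj A B).
Proof.
apply: (iffP existsP) => -[v].
  by case/orP=> /andP[vA /eqP->]; exists v;
     rewrite ?symdiff1_in ?symdiff1_notin.
move=> eB; exists v; rewrite eB.
have [vA|vA] := boolP (v \in val A); first by rewrite symdiff1_in ?eqxx.
by rewrite symdiff1_notin ?eqxx.
Qed.

End VCIrSets.

Section TARHomomorphisms.
Variables (G H : sgraph) (f : VCIr_TAR G -> VCIr_TAR H).
Hypotheses (hG : no_isolated G) (f_inj : injective f)
  (f_adj : forall A B, adj A B -> adj (f A) (f B)).

Let Z : {set H} := val (f (Sub set0 (VCIr_set0 G))).

Lemma TAR_hom_vertex_map :
  exists phi : G -> H,
    forall x, val (f (Sub [set x] (VCIr_set1 x hG))) = symdiff Z [set phi x].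
Proof.
apply: (fin_all_exists (P := fun x y => val (f _) = symdiff Z [set y])).
move=> x; apply/TAR_adjP/f_adj/TAR_adjP; exists x => /=.
by apply/setP=> y; rewrite !inE.
Qed.

Lemma TAR_hom_symdiff :
  exists2 phi : G -> H, injective phi &
    forall A, val (f A) = symdiff Z (phi @: val A).
Proof.
have [phi phi1] := TAR_hom_vertex_map.
have phi_inj : injective phi.
  move=> x y exy.
  have /f_inj/(congr1 val)/= : f (Sub [set x] (VCIr_set1 x hG)) =
                          f (Sub [set y] (VCIr_set1 y hG)).
    by apply: val_inj; rewrite !phi1 exy.
  exact: set1_inj.
exists phi => // A; have [n] := ubnP #|val A|; elim: n A => // n IHn A.
rewrite ltnS => leAn.
have subA (B : {set G}) : B \subset val A -> VCIr_set B.
  by move=> BA; apply: VCIr_setS BA (valP A).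
have imD1 (B : {set G}) x : x \in B ->
    phi @: (B :\ x) = symdiff (phi @: B) [set phi x].
  move=> xB; rewrite -symdiff1_in ?imset_f //; apply/setP=> y.
  apply/imsetP/idP => [[z zBx ->]|].
    by move: zBx; rewrite !inE (inj_eq phi_inj) => /andP[-> zB]; rewrite imset_f.
  rewrite !inE => /andP[yx /imsetP[z zB ey]]; exists z => //.
  by rewrite !inE zB andbT; apply: contraNneq yx => <-; rewrite ey.
(* [A] is a neighbour of [A :\ x], whose image is known by induction. *)
have step x : x \in val A ->
    exists u, val (f A) = symdiff (symdiff Z (phi @: (val A :\ x))) [set u].
  move=> xA; pose B : VCIr_TAR G := Sub (val A :\ x) (subA _ (subsetDl _ _)).
  have <- : val (f B) = symdiff Z (phi @: (val A :\ x)).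
    by rewrite IHn //= (leq_trans _ leAn) // [X in _ < X](cardsD1 x) xA.
  apply/TAR_adjP/f_adj/TAR_adjP; exists x => /=.
  by rewrite -symdiff1_notin ?setD1K // !inE eqxx.
(* The comparison of two deletions below needs two distinct elements of [A]; smaller sets hold by
   the choice of [Z] and [phi]. *)
have [A0|[a aA]] := set_0Vmem (val A).
  rewrite A0 imset0 symdiff0 /Z; congr (val (f _)).
  exact: val_inj.
have [A1|[b bA]] := set_0Vmem (val A :\ a).
  have eA : val A = [set a] by rewrite -(setD1K aA) A1 setU0.
  rewrite eA imset_set1 -phi1; congr (val (f _)).
  exact: val_inj.
have /[!inE]/andP[ba bA'] := bA.
have [[u eu] [v ev]] := (step a aA, step b bA').
(* Both deletions describe [f A]; cancelling [Z] and [phi @: val A] leaves an equality between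
   symmetric differences of singletons. *)
have uab : u = phi a \/ u = phi b.
  apply: (@symdiff_set1_eq _ _ _ _ v); first by rewrite (inj_eq phi_inj) eq_sym.
  apply: (can_inj (symdiffK (phi @: val A))).
  apply: (can_inj (symdiffK Z)).
  rewrite ![symdiff (phi @: _) (symdiff _ _)]symdiffA -!imD1 //.
  by rewrite !symdiffA -eu -ev.
case: uab => eu'.
  rewrite eu eu' imD1 // -!symdiffA; congr symdiff.
  by apply/setP=> y; rewrite !inE addbb addbF.
(* If [u = phi b], then [f A] is the value already taken at [A] without [a] and [b], against
   injectivity. *)
pose C : VCIr_TAR G :=
  Sub (val A :\ a :\ b) (subA _ (subset_trans (subsetDl _ _) (subsetDl _ _))).
have ltCn : #|val C| < n.
  rewrite (leq_trans _ leAn) // [X in _ < X](cardsD1 a) aA add1n ltnS.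
  by rewrite subset_leq_card ?subsetDl.
have eAC : val A = val A :\ a :\ b.
  rewrite -[RHS]/(val C); congr val; apply/f_inj/val_inj.
  by rewrite eu (IHn C ltCn) [phi @: val C](imD1 _ _ bA) symdiffA eu'.
by move: aA; rewrite {1}eAC !inE eqxx andbF.
Qed.

End TARHomomorphisms.

Lemma TAR_iso_leq_card (G H : sgraph) :
  no_isolated G -> isomorphic (VCIr_TAR G) (VCIr_TAR H) -> #|G| <= #|H|.
Proof.
move=> hG [f [/bij_inj f_inj f_adj]].
have [|phi phi_inj _] := TAR_hom_symdiff hG f_inj.
  by move=> A B; rewrite f_adj.
exact: leq_card phi_inj.
Qed.

Lemma isomorphic_sym (G H : sgraph) : isomorphic G H -> isomorphic H G.
Proof.
case=> f [[g fK gK] f_adj]; exists g; split; first by exists f.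
by move=> x y; rewrite -f_adj !gK.
Qed.

Theorem theorem3p66 (G G' : sgraph) (hG : no_isolated G) (hG' : no_isolated G')
  (hiso : isomorphic (VCIr_TAR G) (VCIr_TAR G')) :
  #|G| = #|G'| /\
  exists phi : G' -> G, bijective phi /\
    forall S : {set G'}, VCIr_set (phi @: S) = VCIr_set S.
Proof.
have hiso' := isomorphic_sym hiso.
have eqn : #|G| = #|G'|.
  by apply/eqP; rewrite eqn_leq !TAR_iso_leq_card.
split=> //; have [f [[g fK gK] f_adj]] := hiso'.
have [|phi phi_inj] := TAR_hom_symdiff hG' (can_inj fK).
  by move=> A B; rewrite f_adj.
set Z := val _ => fE.
have phi_bij : bijective phi by apply: inj_card_bij; rewrite ?eqn.
have [psi phiK psiK] := phi_bij.
exists phi; split=> // S; apply/idP/idP => hS.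
  (* The preimage [W] of this set under [f] satisfies [phi @: W = Z :|: phi @: S], so [W] contains
     [S]. *)
  have hD : VCIr_set (phi @: S :\: Z) := VCIr_setS (subsetDl _ _) hS.
  have := fE (g (Sub _ hD)); rewrite gK /=.
  move=> /(congr1 (symdiff Z)); rewrite symdiffK symdiff_setD => eU.
  apply: VCIr_setS (valP (g (Sub _ hD))); apply/subsetP=> x xS.
  by rewrite -(mem_imset _ _ phi_inj) -eU inE imset_f ?orbT.
(* Conversely, [f] sends this set to [Z :|: phi @: S], which contains [phi @: S]. *)
have hD : VCIr_set (S :\: phi @^-1: Z) := VCIr_setS (subsetDl _ _) hS.
apply: VCIr_setS (valP (f (Sub _ hD))); rewrite fE SubK.
have -> : phi @: (S :\: phi @^-1: Z) = phi @: S :\: Z.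
  by apply/setP=> y; rewrite -[y]psiK inE !(mem_imset _ _ phi_inj) !inE.
by rewrite symdiff_setD subsetUr.
Qed.
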